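(* An instance admits a fair periodic assignment requiring exactly $L$ workers if and only if its idle interval graph is weakly connected.
   Context: Let $T$ be a positive integer (the period) and let $\mathcal{I}$ be a finite set of $n\ge 1$ tasks (the instance). For $x\in\mathbb{R}$, $[x]_T$ denotes the unique element of $[0,T)$ congruent to $x$ modulo $T$. Each task $i$ is given by $a_i,b_i\in[0,T)$ and occupies the $T$-periodic open interval $\{t\in[0,T):0<[t-a_i]_T<c(i)\}$, where $c(i):=[b_i-a_i]_T$. For $t\in[0,T)$, $\mathcal{I}(t)$ is the number of tasks whose interval contains $t$, and the load is $L:=\max_t\mathcal{I}(t)$. For each ordered pair $(i,j)$ of tasks (including $i=j$) the transition time is $c_{ij}:=[a_j-b_i]_T$. A periodic assignment is a set $\mathcal{M}\subseteq\mathcal{I}\times\mathcal{I}$ in which every task has exactly one outgoing and one incoming arc; it is fair if it forms a single directed cycle through all tasks. The number of workers required by $\mathcal{M}$ is $(\sum_i c(i)+\sum_{(i,j)\in\mathcal{M}}c_{ij})/T$. An idle interval is a maximal (with respect to inclusion) $T$-periodic closed interval $[s,e]:=\{t\in[0,T):[t-s]_T\le[e-s]_T\}$ such that $\mathcal{I}(t)<L$ for all $t\in[s,e]$. The idle interval graph is the directed multigraph whose nodes are the idle intervals and which has, for every task $i$, one arc $(k,l)$ where $k$ is the idle interval containing $a_i$ and $l$ is the idle interval containing $b_i$.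
   Formalization: The formal theorem assumes that a task with a_i = b_i sits at a time with load below L; otherwise that point lies in no idle interval and the task's arc in the idle interval graph is undefined (e.g. T=10, tasks (0,5), (3,3)). *)

(* Defs.v *)
From Stdlib Require Export Relation_Operators.
From HB Require Import structures.
From mathcomp Require Export all_boot all_order all_algebra.
From mathcomp Require Export boolp classical_sets reals.
Set Implicit Arguments.
Unset Strict Implicit.
Unset Printing Implicit Defensive.
Import Order.TTheory GRing.Theory Num.Theory.
Local Open Scope classical_set_scope.
Local Open Scope ring_scope.

(* Nodes are a subset of the ambient type [V]; parallel arcs and loops are
   allowed, since arcs form a type of their own. *)
Record multidigraph (V : Type) := MultiDigraph {
  node : set V;
  arc : Type;
  src : arc -> V;
  tgt : arc -> V }.

Definition weakly_connected (V : Type) (G : multidigraph V) : Prop :=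
  forall k l : V, node G k -> node G l ->
    clos_refl_sym_trans V
      (fun x y => exists e : arc G, src e = x /\ tgt e = y) k l.

Section PeriodicAssignment.
Context {R : realType}.
Variable T : nat.

(* [x]_T *)
Definition modT (x : R) : R := x - T%:R * (Num.floor (x / T%:R))%:~R.

(* [0, T) *)
Definition timepoint : set R := [set t | 0 <= t < T%:R].

Variables (I : finType) (a b : I -> R).

(* c(i); a task with a_i = b_i has duration 0 and an empty interval. *)
Definition duration (i : I) : R := modT (b i - a i).

Definition active (i : I) (t : R) : bool := 0 < modT (t - a i) < duration i.

Definition load_at (t : R) : nat := #|[pred i : I | active i t]|.

Definition load : nat :=
  \max_(k < #|I|.+1 | `[< exists2 t, timepoint t & load_at t = k >]) k.

(* c_ij *)
Definition transition (i j : I) : R := modT (a j - b i).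

Definition periodic_assignment (M : {set I * I}) : Prop :=
  forall i : I, (exists! j, (i, j) \in M) /\ (exists! j, (j, i) \in M).

(* [path.next s i] is the cyclic successor of [i] in [s]. *)
Definition fair (M : {set I * I}) : Prop :=
  exists s : seq I,
    [/\ uniq s, (forall i, i \in s) & M = [set (i, next s i) | i : I]].

Definition workers (M : {set I * I}) : R :=
  (\sum_(i : I) duration i + \sum_(p in M) transition p.1 p.2) / T%:R.

(* [s, e]; it wraps around T when e < s, and is a single point when s = e. *)
Definition periodic_itv (s e : R) : set R :=
  [set t | timepoint t /\ modT (t - s) <= modT (e - s)].

Definition idle (K : set R) : Prop :=
  (exists s e : R, [/\ timepoint s, timepoint e & K = periodic_itv s e]) /\
  (forall t, K t -> (load_at t < load)%N).

Definition idle_interval (K : set R) : Prop :=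
  idle K /\ (forall K' : set R, idle K' -> K `<=` K' -> K' = K).

(* The idle interval containing [x]; the junk value [set0], which is not an
   idle interval, is returned when there is none. *)
Definition idle_interval_of (x : R) : set R :=
  xget set0 [set K | idle_interval K /\ K x].

Definition idle_interval_graph : multidigraph (set R) :=
  {| node := idle_interval;
     arc := I;
     src := fun i => idle_interval_of (a i);
     tgt := fun i => idle_interval_of (b i) |}.

End PeriodicAssignment.

(* Main.v *)
(* Cut the circle right after a point t0 of maximal load L, so that tasks and
   transitions get endpoints in ]0, T].  Comparing lengths, an assignment needs
   L workers plus one for each transition that passes t0; it needs exactly L iff
   every transition runs forward on the cut circle, and then each transition
   stays inside one idle interval.  Hence the cycle of a fair assignment with L
   workers links all arcs of the idle interval graph, and every idle interval
   ends where some task starts.  Conversely, since the load never exceeds L, at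
   each point at least as many ends as starts lie to its left, so a forward
   matching of ends to starts exists.  Take one with the fewest cycles.  The
   transitions of such a matching cover every idle interval, and exchanging the
   targets of two overlapping transitions of different cycles would merge these
   cycles; so all tasks ending in one idle interval lie on one cycle, and weak
   connectivity leaves a single cycle. *)
Require Import Defs.
From mathcomp Require Import fingroup perm ring lra zify.
Set Implicit Arguments.
Unset Strict Implicit.
Unset Printing Implicit Defensive.
Import Order.TTheory GRing.Theory Num.Theory.
Local Open Scope ring_scope.

(** * Forward matchings *)

Section ForwardMatching.
Variables (R : realDomainType) (I : finType) (f g : I -> R).

Lemma matching_exists (n : nat) (A B : {set I}) :
    #|A| = n -> #|B| = n ->
    (forall x, #|[set j in B | (g j <= x)%R]| <= #|[set i in A | (f i <= x)%R]|)%N ->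
  exists h : I -> I, {in A &, injective h} /\
    (forall i, i \in A -> h i \in B /\ f i <= g (h i)).
Proof.
elim: n A B => [|n IHn] A B cA cB hall.
  move/cards0_eq: cA => ->; exists id; split=> [i j|i]; by rewrite inE.
have [i0 Ai0]: exists i, i \in A by apply/set0Pn; rewrite -card_gt0 cA.
have [j0 Bj0]: exists j, j \in B by apply/set0Pn; rewrite -card_gt0 cB.
pose i := [arg max_(i > i0 in A) f i]%O; pose j := [arg max_(j > j0 in B) g j]%O.
have [Ai maxi] : i \in A /\ forall k, k \in A -> f k <= f i.
  by rewrite /i; case: arg_maxP.
have [Bj maxj] : j \in B /\ forall k, k \in B -> g k <= g j.
  by rewrite /j; case: arg_maxP.
have fg k : k \in A -> f k <= g j.
  move=> Ak; have := hall (g j).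
  rewrite (_ : [set _ in B | _] = B); last first.
    by apply/setP => l; rewrite inE; case Bl: (l \in B); rewrite //= maxj.
  rewrite cB -cA => cardle.
  have /eqP/setP/(_ k) : [set i in A | f i <= g j] == A.
    by rewrite eqEcard cardle andbT; apply/fintype.subsetP=> l; rewrite inE => /andP[].
  by rewrite inE Ak => /andP[].
have cA' : #|A :\ i| = n by move: cA; rewrite (cardsD1 i) Ai => -[].
have cB' : #|B :\ j| = n by move: cB; rewrite (cardsD1 j) Bj => -[].
case: (IHn _ _ cA' cB') => [x|h [injh hP]].
  have [xfi|fxi] := ltP x (f i).
    apply: leq_trans (_ : (#|[set j in B | (g j <= x)%R]| <= _)%N).
      by apply: subset_leq_card; apply/fintype.subsetP=> l; rewrite !inE => /andP[/andP[_ ->]].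
    apply: leq_trans (hall x) _; apply: subset_leq_card; apply/fintype.subsetP=> l.
    rewrite !inE => /andP[-> fl]; rewrite fl !andbT.
    by apply: contraTneq fl => ->; rewrite -ltNge.
  have -> : [set k in A :\ i | f k <= x] = A :\ i.
    apply/setP=> k; rewrite !inE; case: (k != i) => //=; case Ak: (k \in A) => //=.
    exact: le_trans (maxi _ Ak) fxi.
  rewrite cA' -cB'; apply: subset_leq_card; apply/fintype.subsetP=> l.
  by rewrite inE => /andP[].
exists (fun k => if k == i then j else h k); split=> [k l Ak Al|k Ak].
  have [->|ki] := eqVneq k i; have [->|li] := eqVneq l i => //.
  - by move=> jl; have [] := hP l; rewrite !inE ?li // -jl eqxx.
  - by move=> jl; have [] := hP k; rewrite !inE ?ki // jl eqxx.
  - by move=> /injh; rewrite !inE ki li; apply.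
have [->|ki] := eqVneq k i; first by split=> //; apply: fg.
by have [|hB fh] := hP k; rewrite ?inE ?ki //; move: hB; rewrite inE => /andP[].
Qed.

Hypothesis g_le_f : forall x, (#|[set j | (g j <= x)%R]| <= #|[set i | (f i <= x)%R]|)%N.

Definition admissible (s : {perm I}) := [forall i, f i <= g (s i)].

Lemma admissible_exists : exists s, admissible s.
Proof.
have [x|h [injh hP]] := @matching_exists #|I| [set: I] [set: I] (cardsT I) (cardsT I).
  by apply: leq_trans (leq_trans _ (g_le_f x)) _; apply: subset_leq_card;
     apply/fintype.subsetP=> l; rewrite !inE.
have injh' : injective h by move=> i j; apply: injh.
exists (perm injh'); apply/forallP=> i; rewrite permE.
by have [] := hP i (finset.in_setT i).
Qed.

Lemma transition_through (s : {perm I}) (x : R) : admissible s ->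
  (#|[set j | (g j <= x)%R]| < #|[set i | (f i <= x)%R]|)%N ->
  exists i, f i <= x < g (s i).
Proof.
move=> /forallP sP; apply: contraTP => /forallNP noi; rewrite -leqNgt.
rewrite -(card_imset _ (@perm_inj _ s)).
apply: subset_leq_card; apply/fintype.subsetP=> _ /imsetP[i + ->].
rewrite !inE => fxi; rewrite leNgt; apply/negP=> xg; apply: (noi i).
by rewrite fxi.
Qed.

Lemma admissible_swap (s : {perm I}) (i k : I) (x : R) : admissible s ->
  f i <= x <= g (s i) -> f k <= x <= g (s k) ->
  admissible (tperm i k * s)%g.
Proof.
move=> /forallP sP /andP[fi gi] /andP[fk gk]; apply/forallP=> l; rewrite permM.
case: tpermP => [->|->|_ _]; [exact: le_trans fi gk|exact: le_trans fk gi|exact: sP].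
Qed.

(* An admissible permutation with the fewest cycles: a swap of two overlapping
   transitions of distinct cycles would merge these cycles. *)
Lemma merged_matching : exists s : {perm I}, admissible s /\
  forall i k, f i <= f k ->
    (forall x, f i <= x < f k ->
      (#|[set j | (g j <= x)%R]| < #|[set i | (f i <= x)%R]|)%N) ->
    i \in porbit s k.
Proof.
have [s0 s0P] := admissible_exists.
case: (arg_minnP (fun s : {perm I} => #|porbits s|) s0P) => s sP smin.
exists s; split=> // i k.
have overlap j l x : f j <= x <= g (s j) -> f l <= x <= g (s l) -> j \in porbit s l.
  move=> jx lx; apply: contraT => jl.
  have jl' : j != l by apply: contraNneq jl => ->; apply: porbit_id.
  have := smin _ (admissible_swap sP jx lx).
  have := porbits_mul_tperm s j l => /=; rewrite jl jl' /=.
  by rewrite !addn1 addn2 => -[<-]; rewrite ltnn.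
move=> fik cover; apply: contraT => ik.
pose P := [pred l | (l \notin porbit s k) && (f l <= f k) && (f i <= g (s l))].
have sP' l : f l <= g (s l) by move/forallP: sP.
have Pi : P i by rewrite /= ik fik sP'.
case: (@Order.TotalTheory.arg_maxP _ _ _ i P (fun l => g (s l)) Pi) => l /andP[/andP[lk flk] fil] lmax.
have [kl|lk'] := leP (f k) (g (s l)).
  by rewrite (overlap l k (f k)) ?flk ?kl ?lexx ?sP' in lk.
have [|m /andP[fm gm]] := transition_through sP (cover (g (s l)) _).
  by rewrite fil.
have ml : m \in porbit s l.
  by apply: (overlap _ _ (g (s l))); rewrite ?fm ?(ltW gm) ?sP' ?lexx.
have Pm : P m.
  rewrite /= (le_trans fm (ltW lk')) (le_trans fil (ltW gm)) !andbT.
  apply: contra lk => mk; move: ml mk; rewrite -!eq_porbit_mem => /eqP -> /eqP ->.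
  exact: eqxx.
by have /= := lmax m Pm; rewrite leNgt gm.
Qed.

End ForwardMatching.

(** * The cut circle *)

Section Modulo.
Variables (R : realType) (T : nat).
Hypothesis T_gt0 : (0 < T)%N.

Lemma modT_sub (x y : R) : timepoint T x -> timepoint T y ->
  modT T (x - y) = if y <= x then x - y else x - y + T%:R.
Proof.
rewrite /timepoint /= => /andP[x0 xT] /andP[y0 yT].
have T0 : 0 < T%:R :> R by rewrite ltr0n.
rewrite /modT; case: leP => yx.
  have -> : Num.floor ((x - y) / T%:R) = 0.
    by apply: floor_def; rewrite add0r mulr0z mulr1z ler_pdivlMr // ltr_pdivrMr //; lra.
  by rewrite mulr0z mulr0 subr0.
have -> : Num.floor ((x - y) / T%:R) = -1.
  by apply: floor_def; rewrite addNr mulr0z mulrN1z ler_pdivlMr // ltr_pdivrMr //; lra.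
by rewrite mulrN1z mulrN mulr1 opprK.
Qed.

End Modulo.

Section Cut.
Variables (R : realType) (T : nat) (t0 : R).
Hypotheses (T_gt0 : (0 < T)%N) (t0P : timepoint T t0).

(* Cutting the circle right after [t0] identifies it with ]0, T]. *)
Definition pos (x : R) : R := if t0 < x then x - t0 else x - t0 + T%:R.

Lemma pos_itv (x : R) : timepoint T x -> 0 < pos x <= T%:R.
Proof.
move: t0P; rewrite /timepoint /pos /= => /andP[? ?] /andP[? ?].
by case: (ltP t0 x) => ?; apply/andP; split; lra.
Qed.

Lemma pos_cut : pos t0 = T%:R.
Proof. by rewrite /pos ltxx subrr add0r. Qed.

Lemma pos_inj (x y : R) : timepoint T x -> timepoint T y -> pos x = pos y -> x = y.
Proof.
rewrite /timepoint /pos /= => /andP[? ?] /andP[? ?].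
by case: (ltP t0 x) => ?; case: (ltP t0 y) => ?; lra.
Qed.

Lemma pos_surj (z : R) : 0 < z <= T%:R -> exists2 x, timepoint T x & pos x = z.
Proof.
move: t0P; rewrite /timepoint /pos /= => /andP[? ?] /andP[? ?].
have [zT|Tz] := ltP (z + t0) T%:R.
  by exists (z + t0); [apply/andP; split; lra|case: ifP => /idP ?; lra].
by exists (z + t0 - T%:R); [apply/andP; split; lra|case: ifP => /idP ?; lra].
Qed.

Lemma modT_pos (s e : R) : timepoint T s -> timepoint T e ->
  modT T (e - s) = pos e - pos s + (if pos e < pos s then T%:R else 0).
Proof.
move=> sP eP; rewrite modT_sub //; move: t0P sP eP.
rewrite /timepoint /pos /= => /andP[? ?] /andP[? ?] /andP[? ?].
by case: (leP s e) => ?; case: (ltP t0 s) => ?; case: (ltP t0 e) => ?;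
  case: ifP => /idP ?; lra.
Qed.

Lemma modT_le_pos (s e t : R) : timepoint T s -> timepoint T e -> timepoint T t ->
  pos s <= pos e ->
  (modT T (t - s) <= modT T (e - s)) = (pos s <= pos t <= pos e).
Proof.
move=> sP eP tP; rewrite !modT_pos //.
move: (pos_itv sP) (pos_itv eP) (pos_itv tP) => /andP[? ?] /andP[? ?] /andP[? ?] ?.
case: (ltP (pos t) (pos s)) => ?; case: (ltP (pos e) (pos s)) => ?;
  case: (leP (pos t) (pos e)) => ?; apply/idP/idP => //=; lra.
Qed.

Lemma modT_active_pos (s e t : R) :
  timepoint T s -> timepoint T e -> timepoint T t ->
  (0 < modT T (t - s) < modT T (e - s)) =
  if pos s <= pos e then pos s < pos t < pos e else (pos s < pos t) || (pos t < pos e).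
Proof.
move=> sP eP tP; rewrite !modT_pos //.
move: (pos_itv sP) (pos_itv eP) (pos_itv tP) => /andP[? ?] /andP[? ?] /andP[? ?].
case: (ltP (pos e) (pos s)) => ?; case: (ltP (pos t) (pos s)) => ?;
  case: (ltP (pos s) (pos t)) => ?; case: (ltP (pos t) (pos e)) => ? /=;
  apply/idP/idP => //; lra.
Qed.

Lemma modT_le_wrap (s e : R) : timepoint T s -> timepoint T e ->
  pos e < pos s -> modT T (t0 - s) <= modT T (e - s).
Proof.
move=> sP eP; rewrite !modT_pos // pos_cut.
move: (pos_itv sP) (pos_itv eP) => /andP[? ?] /andP[? ?] ?.
by case: ifP => ?; case: ifP => ?; lra.
Qed.

End Cut.

Lemma card_set_sum (I : finType) (P : pred I) :
  #|[set i | P i]| = (\sum_(i : I) (P i : nat))%N.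
Proof.
by rewrite -sum1dep_card big_mkcond; apply: eq_bigr => i _; case: (P i).
Qed.

Section Load.
Variables (R : realType) (T : nat) (I : finType) (a b : I -> R).
Hypothesis T_gt0 : (0 < T)%N.

Lemma load_at_sum (t : R) :
  load_at T a b t = (\sum_(i : I) (active T a b i t : nat))%N.
Proof. by rewrite -card_set_sum cardsE. Qed.

Lemma load_at_le (t : R) : timepoint T t -> (load_at T a b t <= load T a b)%N.
Proof.
move=> tP; have ltI : (load_at T a b t < #|I|.+1)%N by rewrite ltnS max_card.
by rewrite /load; apply: (leq_bigmax_cond (Ordinal ltI)); apply/asboolP; exists t.
Qed.

Lemma load_attained : exists2 t, timepoint T t & load_at T a b t = load T a b.
Proof.
have tP : timepoint T (0 : R) by rewrite /timepoint /= lexx ltr0n.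
have ltI : (load_at T a b 0 < #|I|.+1)%N by rewrite ltnS max_card.
pose A := [pred k : 'I_#|I|.+1 | `[< exists2 t, timepoint T t & load_at T a b t = k >]].
have [|k kA] := @eq_bigmax_cond _ A (fun k => k : nat).
  by apply/card_gt0P; exists (Ordinal ltI); apply/asboolP; exists 0.
rewrite /load => ->.
by have /asboolP[t ? ?] := kA; exists t.
Qed.

End Load.

(** * The load on the cut circle *)

Section CutInstance.
Variables (R : realType) (T : nat) (I : finType) (a b : I -> R) (t0 : R).
Hypotheses (T_gt0 : (0 < T)%N) (a_itv : forall i, timepoint T (a i))
  (b_itv : forall i, timepoint T (b i))
  (arc_defined : forall i, a i = b i -> (load_at T a b (a i) < load T a b)%N)
  (t0P : timepoint T t0) (t0_load : load_at T a b t0 = load T a b).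

Local Notation pos := (pos T t0).
Local Notation load_at := (load_at T a b).
Local Notation load := (load T a b).

Definition apos (i : I) := pos (a i).
Definition bpos (i : I) := pos (b i).

Lemma apos_itv (i : I) : 0 < apos i <= T%:R.
Proof. exact: pos_itv. Qed.

Lemma bpos_itv (i : I) : 0 < bpos i <= T%:R.
Proof. exact: pos_itv. Qed.

Lemma active_pos (i : I) (t : R) : timepoint T t ->
  active T a b i t =
  if apos i <= bpos i then apos i < pos t < bpos i
  else (apos i < pos t) || (pos t < bpos i).
Proof. by move=> tP; rewrite /active /duration (modT_active_pos (t0 := t0)). Qed.

(* Moving the last cardinality to the left gives the number of half-open
   intervals [a_i, b_i[ that contain [x], that is, the load just after [x]. *)
Lemma load_right (x y : R) : 0 <= x -> x < y -> y <= T%:R ->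
  exists t, [/\ timepoint T t, x < pos t < y &
    (#|[set i | (bpos i < apos i)%R]| + #|[set i | (apos i <= x)%R]| <=
     load_at t + #|[set i | (bpos i <= x)%R]|)%N].
Proof.
move=> x0 xy yT; pose m := \big[Order.min/y]_(i : I | x < bpos i) bpos i.
have xm : x < m by apply: lt_bigmin.
have my : m <= y by apply: bigmin_le_id.
have [|t tP tE] := @pos_surj R T t0 t0P ((x + m) / 2); first by apply/andP; split; lra.
exists t; split; [by []|by rewrite tE; apply/andP; split; lra|].
rewrite load_at_sum !card_set_sum -!big_split leq_sum // => i _.
rewrite active_pos // tE.
have mb : x < bpos i -> m <= bpos i by move=> ?; apply: bigmin_le_cond.
case: (ltP x (bpos i)) mb => [xb /(_ isT) mb|bx _]; case: (leP (apos i) x) => ax;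
  case: (leP (apos i) (bpos i)) => ab //=.
- have -> : apos i < (x + m) / 2 < bpos i by apply/andP; split; lra.
  by [].
- lra.
- have -> : (x + m) / 2 < bpos i by lra.
  by rewrite orbT.
- by rewrite leq_addl.
- have -> : apos i < (x + m) / 2 by lra.
  by [].
- by rewrite leq_addl.
Qed.

Lemma wrap_load : #|[set i | bpos i < apos i]| = load.
Proof.
have T0 : 0 < T%:R :> R by rewrite ltr0n.
apply/eqP; rewrite eqn_leq; apply/andP; split.
  have [t [tP _]] := load_right (lexx 0) T0 (lexx _).
  rewrite (_ : [set i | bpos i <= 0] = finset.set0); last first.
    by apply/setP => i; rewrite !inE leNgt; have /andP[->] := bpos_itv i.
  rewrite cards0 addn0 => le_load; apply: leq_trans (load_at_le a b tP).
  exact: leq_trans (leq_addr _ _) le_load.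
rewrite -t0_load load_at_sum card_set_sum leq_sum // => i _.
rewrite active_pos // pos_cut; have /andP[_ aT] := apos_itv i; have /andP[_ bT] := bpos_itv i.
case: (leP (apos i) (bpos i)) => ab; last exact: leq_b1.
by rewrite [T%:R < _]ltNge bT andbF.
Qed.

Lemma starts_le_ends (x : R) :
  (#|[set i | (apos i <= x)%R]| <= #|[set i | (bpos i <= x)%R]|)%N.
Proof.
have [x0|x0] := ltP x 0.
  rewrite (_ : [set i | apos i <= x] = finset.set0) ?cards0 //.
  by apply/setP => i; rewrite !inE; have /andP[? _] := apos_itv i; apply/idP; lra.
have [xT|Tx] := ltP x T%:R.
  have [t [tP _]] := load_right x0 xT (lexx _).
  rewrite wrap_load => h; have := load_at_le a b tP.
  by move: h; rewrite /Defs.load_at; lia.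
rewrite (_ : [set i | bpos i <= x] = [set: I]) ?cardsT ?max_card //.
by apply/setP => i; rewrite !inE; have /andP[_ ?] := bpos_itv i; apply/idP; lra.
Qed.

Lemma starts_lt_ends (x y : R) : 0 <= x -> x < y -> y <= T%:R ->
  (forall t, timepoint T t -> x < pos t < y -> (load_at t < load)%N) ->
  (#|[set i | (apos i <= x)%R]| < #|[set i | (bpos i <= x)%R]|)%N.
Proof.
move=> x0 xy yT idle_xy; have [t [tP xty]] := load_right x0 xy yT.
rewrite wrap_load => h; have := idle_xy t tP xty.
move: h; move: (Defs.load_at _ _ _ _) => u; lia.
Qed.

(* A task of duration 0 at [t] counts as an end, but not as a start, before
   [t]; the last term compensates for it. *)
Lemma load_at_balance (t : R) : timepoint T t ->
  (load_at t + #|[set i | (bpos i <= pos t)%R]| =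
   load + #|[set i | (apos i < pos t)%R]|
   + #|[set i | (apos i == pos t) && (bpos i == pos t)]|)%N.
Proof.
move=> tP; rewrite -wrap_load load_at_sum !card_set_sum -!big_split /=.
apply: eq_bigr => i _; rewrite active_pos //.
case: (leP (apos i) (bpos i)) => ?; case: (ltP (apos i) (pos t)) => ?;
  case: (leP (bpos i) (pos t)) => ?; case: eqP => ?; case: eqP => ? //=; exfalso; lra.
Qed.


(** * Idle intervals *)

Definition span (s e : R) : set R := [set t | timepoint T t /\ pos s <= pos t <= pos e]%classic.

Lemma periodic_itv_span (s e : R) : timepoint T s -> timepoint T e ->
  pos s <= pos e -> periodic_itv T s e = span s e.
Proof.
move=> sP eP se; apply/funext => t; apply/propext; rewrite /periodic_itv /span /=.
by split=> -[tP]; rewrite (modT_le_pos (t0 := t0)).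
Qed.

Lemma idle_span (K : set R) : idle T a b K <->
  exists s e, [/\ timepoint T s, timepoint T e, pos s <= pos e, K = span s e &
    forall t, timepoint T t -> pos s <= pos t <= pos e -> (load_at t < load)%N].
Proof.
split=> [[[s [e [sP eP ->]]] low]|[s [e [sP eP se -> low]]]].
  have se : pos s <= pos e.
    rewrite leNgt; apply/negP=> es.
    suff: (load_at t0 < load)%N by rewrite t0_load ltnn.
    by apply: low; split=> //; apply: modT_le_wrap.
  exists s, e; split=> // [|t tP tin]; first exact: periodic_itv_span.
  by apply: low; rewrite periodic_itv_span.
split; first by exists s, e; split=> //; rewrite periodic_itv_span.
by move=> t [tP]; apply: low.
Qed.

Lemma crossing (e : R) : timepoint T e -> (load_at e < load)%N ->
  exists i, bpos i <= pos e <= apos i.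
Proof.
move=> eP; apply: contraTP => /forallNP nocross; rewrite -leqNgt -t0_load.
apply: subset_leq_card; apply/fintype.subsetP=> i; rewrite !inE.
rewrite !active_pos // pos_cut; move: (nocross i) (apos_itv i) (bpos_itv i).
move=> /negP; rewrite negb_and -!ltNge => /orP ncr /andP[? ?] /andP[? ?].
case: (leP (apos i) (bpos i)) => ab; first by move=> /andP[_ ?]; exfalso; lra.
by case: ncr => ->; rewrite ?orbT.
Qed.

(* Away from an idle point the load does not exceed its value there before the
   next task starts. *)
Lemma idle_extend_right (e : R) : timepoint T e -> (load_at e < load)%N ->
  exists2 j, pos e <= apos j &
    forall t, timepoint T t -> pos e <= pos t <= apos j -> (load_at t < load)%N.
Proof.
move=> eP low; have [i /andP[_ ei]] := crossing eP low.
have [j ej jmin] := @Order.TotalTheory.arg_minP _ _ _ i (fun j => pos e <= apos j) apos ei.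
exists j => // t tP /andP[et tj]; apply: leq_ltn_trans low.
apply: subset_leq_card; apply/fintype.subsetP=> k; rewrite !inE !active_pos //.
have ke : apos k < pos t -> apos k < pos e.
  by rewrite !ltNge; apply: contra => /jmin; apply: le_trans.
case: ifP => _; first by move=> /andP[/ke -> tb]; apply: le_lt_trans tb.
by move=> /orP[/ke -> //|tb]; rewrite (le_lt_trans et tb) orbT.
Qed.

Lemma idle_extend_left (s : R) : timepoint T s -> (load_at s < load)%N ->
  exists2 i, bpos i <= pos s &
    forall t, timepoint T t -> bpos i <= pos t <= pos s -> (load_at t < load)%N.
Proof.
move=> sP low; have [j /andP[js _]] := crossing sP low.
have [i si imax] := @Order.TotalTheory.arg_maxP _ _ _ j (fun i => bpos i <= pos s) bpos js.
exists i => // t tP /andP[it ts]; apply: leq_ltn_trans low.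
apply: subset_leq_card; apply/fintype.subsetP=> k; rewrite !inE !active_pos //.
have ks : pos t < bpos k -> pos s < bpos k.
  by rewrite !ltNge; apply: contra => /imax bki; apply: le_trans bki it.
case: ifP => _; first by move=> /andP[at_ /ks ->]; rewrite (lt_le_trans at_ ts).
by move=> /orP[at_|/ks ->]; rewrite ?orbT // (lt_le_trans at_ ts).
Qed.

Definition idle_pair (i j : I) := forall t, timepoint T t ->
  bpos i <= pos t <= apos j -> (load_at t < load)%N.

Lemma idle_extend (s e : R) : timepoint T s -> timepoint T e -> pos s <= pos e ->
  (forall t, timepoint T t -> pos s <= pos t <= pos e -> (load_at t < load)%N) ->
  exists i j, [/\ bpos i <= pos s, pos e <= apos j & idle_pair i j].
Proof.
move=> sP eP se low.
have [|i si lowl] := idle_extend_left sP; first by apply: low; rewrite ?lexx ?se.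
have [|j ej lowr] := idle_extend_right eP; first by apply: low; rewrite ?lexx ?se.
exists i, j; split=> // t tP /andP[it tj].
have [ts|st] := leP (pos t) (pos s); first by apply: lowl; rewrite ?it ?ts.
have [te|et] := leP (pos t) (pos e); first by apply: low; rewrite ?te ?ltW.
by apply: lowr; rewrite ?tj ?ltW.
Qed.

Lemma idle_interval_ends (K : set R) : idle_interval T a b K ->
  exists i j, bpos i <= apos j /\ K = span (b i) (a j).
Proof.
move=> [/idle_span[s [e [sP eP se -> low]]] Kmax].
have [i [j [is_ ej lowij]]] := idle_extend sP eP se low.
have ij : bpos i <= apos j by lra.
exists i, j; split=> //; apply/esym/Kmax; first by apply/idle_span; exists (b i), (a j).
by move=> t [tP /andP[st te]]; split=> //; apply/andP; split; [exact: le_trans st|exact: le_trans ej].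
Qed.

Lemma idle_interval_exists (p : R) : timepoint T p -> (load_at p < load)%N ->
  exists K, idle_interval T a b K /\ K p.
Proof.
move=> pP low.
have lowp t : timepoint T t -> pos p <= pos t <= pos p -> (load_at t < load)%N.
  by move=> tP /le_anti /(pos_inj pP tP) <-.
have [i0 [j0 [ip0 pj0 low0]]] := idle_extend pP pP (lexx _) lowp.
pose P (ij : I * I) := [&& bpos ij.1 <= pos p, pos p <= apos ij.2 & `[< idle_pair ij.1 ij.2 >]].
have P0 : P (i0, j0) by rewrite /P /= ip0 pj0; apply/asboolP.
have [[i j] /and3P[/= ip pj /asboolP lowij] ijmax] :=
  @Order.TotalTheory.arg_maxP _ _ _ (i0, j0) P (fun ij => apos ij.2 - bpos ij.1) P0.
exists (span (b i) (a j)); split; last by split=> //; apply/andP.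
split; first by apply/idle_span; exists (b i), (a j); split=> //; apply: le_trans ip pj.
move=> _ /idle_span[s [e [sP eP se -> low']]] sub.
have ij : bpos i <= apos j by apply: le_trans ip pj.
have [_ /andP[si _]] : span s e (b i) by apply: sub; split=> //; apply/andP.
have [_ /andP[_ je]] : span s e (a j) by apply: sub; split=> //; apply/andP.
have [k [l [ks el lowkl]]] := idle_extend sP eP se low'.
rewrite -/(bpos _) -/(apos _) in si je.
have /ijmax /= lenle : P (k, l).
  by apply/and3P; split; [rewrite /=; lra|rewrite /=; lra|apply/asboolP].
have sE : pos s = bpos i by lra.
have eE : pos e = apos j by lra.
by rewrite (pos_inj sP (b_itv i) sE) (pos_inj eP (a_itv j) eE).
Qed.

Lemma idle_subset (J K : set R) (p : R) : idle T a b J -> idle_interval T a b K ->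
  J p -> K p -> (J `<=` K)%classic.
Proof.
move=> /idle_span[s [e [sP eP se -> low]]] [/idle_span[s' [e' [sP' eP' se' -> low']]] Kmax].
move=> [pP /andP[sp pe]] [_ /andP[sp' pe']].
have [m [mP mle mge]] : exists m, [/\ timepoint T m, pos m <= pos s, pos m <= pos s' &
    pos m = pos s \/ pos m = pos s'].
  by have [ss|ss] := leP (pos s) (pos s'); [exists s|exists s']; split=> //; [left|exact: ltW|right].
move=> mE.
have [M [MP Mle Mge ME]] : exists M, [/\ timepoint T M, pos e <= pos M, pos e' <= pos M &
    pos M = pos e \/ pos M = pos e'].
  by have [ee|ee] := leP (pos e) (pos e'); [exists e'|exists e]; split=> //; [right|exact: ltW|left].
have idleU : idle T a b (span m M).
  apply/idle_span; exists m, M; split=> // [|t tP /andP[mt tM]]; first by lra.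
  have [st|ts] := leP (pos s) (pos t); have [te|et] := leP (pos t) (pos e).
  - by apply: low; rewrite ?st.
  - by apply: low' => //; apply/andP; case: ME => ?; split; lra.
  - by apply: low' => //; apply/andP; case: mE => ?; split; lra.
  - by lra.
rewrite -(Kmax _ idleU) => t [tP /andP[? ?]]; split=> //; apply/andP; split; lra.
Qed.

Lemma idle_interval_ofP (p : R) : timepoint T p -> (load_at p < load)%N ->
  idle_interval T a b (idle_interval_of T a b p) /\ idle_interval_of T a b p p.
Proof. by move=> pP low; apply: (xgetPex _ (idle_interval_exists pP low)). Qed.

Lemma idle_interval_of_unique (K : set R) (p : R) :
  idle_interval T a b K -> K p -> idle_interval_of T a b p = K.
Proof.
move=> Kmax Kp; have [idK _] := Kmax.
have [pP low] : timepoint T p /\ (load_at p < load)%N.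
  have [[s [e [_ _ KE]]] low] := idK.
  by split; [move: Kp; rewrite KE => -[]|exact: low].
have [of_max of_p] := idle_interval_ofP pP low.
apply/seteqP; split; [exact: (idle_subset of_max.1 Kmax of_p Kp)|].
exact: (idle_subset idK of_max Kp of_p).
Qed.

Lemma idle_interval_of_eq (J : set R) (p q : R) : idle T a b J -> J p -> J q ->
  idle_interval_of T a b p = idle_interval_of T a b q.
Proof.
move=> idJ Jp Jq.
have [pP low] : timepoint T p /\ (load_at p < load)%N.
  have [[s [e [_ _ JE]]] low] := idJ.
  by split; [move: Jp; rewrite JE => -[]|exact: low].
have [of_max of_p] := idle_interval_ofP pP low.
by apply/esym/idle_interval_of_unique => //; apply: (idle_subset idJ of_max Jp of_p).
Qed.

Lemma admissible_idle (s : {perm I}) (i : I) : admissible bpos apos s ->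
  idle T a b (span (b i) (a (s i))).
Proof.
move=> /forallP sP; apply/idle_span; exists (b i), (a (s i)); split=> //; first exact: sP.
move=> t tP /andP[bt ta].
have [[k /andP[/eqP kt /eqP kt']]|/forallNP nozero] :=
    pselect (exists k, (apos k == pos t) && (bpos k == pos t)).
  have tE : t = a k by apply: (@pos_inj R T t0) => //; rewrite -kt.
  rewrite tE; apply: arc_defined; apply: (@pos_inj R T t0) => //.
  by rewrite -/(apos k) -/(bpos k) kt.
have := load_at_balance tP.
rewrite (_ : [set k | _ & _] = finset.set0); last first.
  by apply/setP => k; rewrite !inE; apply/negP/nozero.
have lt_count : (#|[set k | (apos k < pos t)%R]| < #|[set k | (bpos k <= pos t)%R]|)%N.
  rewrite -(card_preimset _ (@perm_inj _ s)); apply: proper_card; apply/properP; split.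
    by apply/fintype.subsetP=> k; rewrite !inE => akt; apply: le_trans (sP k) (ltW akt).
  by exists i; rewrite !inE // -leNgt.
rewrite cards0 addn0; move: (Defs.load_at _ _ _ _) (Defs.load _ _ _) => u v; lia.
Qed.

Lemma workers_graph (s : {perm I}) : workers T a b [set (i, s i) | i : I] =
  (load + #|[set i | apos (s i) < bpos i]|)%:R.
Proof.
have T0 : T%:R != 0 :> R by rewrite pnatr_eq0 -lt0n.
rewrite /workers big_imset /=; last by move=> i j _ _ [].
rewrite -wrap_load !card_set_sum natrD !natr_sum.
apply: (mulIf T0); rewrite mulfVK // mulrDl !mulr_suml.
have modE (x y : R) : timepoint T x -> timepoint T y ->
    modT T (y - x) = pos y - pos x + (pos y < pos x)%R%:R * T%:R.
  by move=> xP yP; rewrite (modT_pos (t0 := t0)) //; case: ifP => _; rewrite ?mul1r ?mul0r.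
under eq_bigr do rewrite /duration modE //.
under [X in _ + X]eq_bigr do rewrite /transition modE //.
rewrite !big_split /= !sumrN [\sum_i pos (a (s i))](reindex_inj (@perm_inj _ s^-1)) /=.
under [X in _ + (X - _ + _)]eq_bigr do rewrite permKV.
rewrite /apos /bpos; ring.
Qed.

Lemma workers_admissible (s : {perm I}) :
  workers T a b [set (i, s i) | i : I] = load%:R <-> admissible bpos apos s.
Proof.
rewrite workers_graph; split=> [/eqP|/forallP sP].
  rewrite eqr_nat -{2}[Defs.load _ _ _]addn0 eqn_add2l cards_eq0 => /eqP/setP noi.
  by apply/forallP=> i; have := noi i; rewrite !inE leNgt => ->.
rewrite (_ : [set i | _] = finset.set0) ?cards0 ?addn0 //.
by apply/setP=> i; rewrite !inE ltNge sP.
Qed.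

(** * Cycles and connectivity *)

Lemma endpoint_idle_interval_eq (s : {perm I}) (i : I) : admissible bpos apos s ->
  idle_interval_of T a b (b i) = idle_interval_of T a b (a (s i)).
Proof.
move=> sP; have bas : bpos i <= apos (s i) by move/forallP: sP.
by apply: (idle_interval_of_eq (admissible_idle i sP)); split=> //; rewrite lexx bas.
Qed.

Lemma load_end_lt (i : I) : (load_at (b i) < load)%N.
Proof.
have [s sP] := admissible_exists starts_le_ends.
have [_ low] := admissible_idle i sP.
by apply: low; split=> //; rewrite lexx; move/forallP: sP; apply.
Qed.

Lemma cycle_connected (s : {perm I}) : admissible bpos apos s ->
  (forall i j, j \in porbit s i) -> weakly_connected (idle_interval_graph T a b).
Proof.
move=> sP cyc K J Kmax Jmax.
have ofb M : idle_interval T a b M -> exists i, M = idle_interval_of T a b (b i).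
  move=> Mmax; have [i [j [ij ME]]] := idle_interval_ends Mmax.
  by exists i; apply/esym/idle_interval_of_unique => //; rewrite ME; split=> //; rewrite lexx.
have [i ->] := ofb K Kmax; have [j ->] := ofb J Jmax.
have /porbitP[n ->] := cyc i j.
elim: n => [|n IHn]; first by rewrite expg0 perm1; apply: rst_refl.
apply: rst_trans IHn _; rewrite expgSr permM (endpoint_idle_interval_eq _ sP).
by apply: rst_step; exists (s ((s ^+ n)%g i)).
Qed.

Lemma idle_interval_covered (i k : I) (x : R) :
  idle_interval_of T a b (b i) = idle_interval_of T a b (b k) ->
  bpos i <= x < bpos k ->
  (#|[set j | (apos j <= x)%R]| < #|[set j | (bpos j <= x)%R]|)%N.
Proof.
move=> eq_of /andP[ix xk].
have [[idK _] Ki] := idle_interval_ofP (b_itv i) (load_end_lt i).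
have [_ Kk] := idle_interval_ofP (b_itv k) (load_end_lt k).
rewrite -eq_of in Kk.
move/idle_span: idK => [s [e [_ _ _ KE low]]]; rewrite KE in Ki Kk.
have [[_ /andP[si _]] [_ /andP[_ ke]]] := (Ki, Kk).
have /andP[i0 _] := bpos_itv i; have /andP[_ kT] := bpos_itv k.
apply: starts_lt_ends (xk) kT _ => [|t tP /andP[xt tk]]; first exact: ltW (lt_le_trans i0 ix).
apply: low => //; apply/andP; split.
  exact: le_trans si (le_trans ix (ltW xt)).
exact: le_trans (ltW tk) ke.
Qed.

Lemma connected_cycle : weakly_connected (idle_interval_graph T a b) ->
  exists2 s : {perm I}, admissible bpos apos s & forall i j, j \in porbit s i.
Proof.
move=> conn; have [s [sP merged]] := merged_matching starts_le_ends.
exists s => // i j.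
have same k l : idle_interval_of T a b (b k) = idle_interval_of T a b (b l) ->
    k \in porbit s l.
  move=> eq_of; have [kl|lk] := leP (bpos k) (bpos l).
    by apply: merged => // x; apply: idle_interval_covered.
  by rewrite porbit_sym; apply: merged (ltW lk) _ => x; apply: idle_interval_covered.
pose cyc K : set I := [set l | exists2 k, idle_interval_of T a b (b k) = K & l \in porbit s k]%classic.
have cycE K k : idle_interval_of T a b (b k) = K -> cyc K = [set` porbit s k]%classic.
  move=> kK; apply/seteqP; split=> l /=; last by exists k.
  move=> [m mK lm]; have := same m k; rewrite mK kK => /(_ erefl).
  by rewrite -eq_porbit_mem => /eqP <-.
have cyc_inv K J : clos_refl_sym_trans _ (fun x y => exists e : I,
    idle_interval_of T a b (a e) = x /\ idle_interval_of T a b (b e) = y) K J ->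
    cyc K = cyc J.
  elim=> [x y [e [ea eb]]|x|x y _ ->|x y z _ -> _ ->] //.
  rewrite (cycE y e eb) (cycE x ((s^-1)%g e)); last first.
    by rewrite (endpoint_idle_interval_eq _ sP) permKV.
  by rewrite -(porbit_perm s 1 (s^-1%g e)) expg1 permKV.
have node_of k : idle_interval T a b (idle_interval_of T a b (b k)).
  by have [] := idle_interval_ofP (b_itv k) (load_end_lt k).
have := cyc_inv _ _ (conn _ _ (node_of i) (node_of j)).
rewrite (cycE _ i erefl) (cycE _ j erefl) => /seteqP[_ /(_ j)]; apply.
exact: porbit_id.
Qed.

End CutInstance.

Lemma fair_perm (I : finType) (M : {set I * I}) : fair M ->
  exists2 s : {perm I}, M = [set (i, s i) | i : I] & forall i j, j \in porbit s i.
Proof.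
move=> [q [Uq allq ->]]; exists (perm (can_inj (prev_next Uq))).
  by apply: eq_imset => i; rewrite permE.
move=> i j; apply/porbitP.
have ij : fconnect (next q) i j by rewrite (fconnect_cycle (cycle_next Uq)).
exists (findex (next q) i j); rewrite permX -[LHS](iter_findex ij).
by apply: eq_iter => k; rewrite permE.
Qed.

Lemma perm_fair (I : finType) (s : {perm I}) : (0 < #|I|)%N ->
  (forall i j, j \in porbit s i) -> fair [set (i, s i) | i : I].
Proof.
move=> /card_gt0P[i0 _] cyc; exists (orbit s i0).
have all_orbit i : i \in orbit s i0.
  by rewrite -fconnect_orbit; have /porbitP[n ->] := cyc i0 i; rewrite permX fconnect_iter.
split; [exact: orbit_uniq|by []|].
apply: eq_imset => i; congr pair; apply/eqP.
exact: (next_cycle (cycle_orbit (@perm_inj _ s) i0) (all_orbit i)).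
Qed.

Lemma perm_periodic_assignment (I : finType) (s : {perm I}) :
  periodic_assignment [set (i, s i) | i : I].
Proof.
have mem i j : ((i, j) \in [set (k, s k) | k : I]) = (s i == j).
  by apply/imsetP/eqP => [[k _ [-> ->]]|<-] //; exists i.
move=> i; split.
  by exists (s i); split=> [|j]; rewrite mem ?eqxx // => /eqP.
exists ((s^-1)%g i); split=> [|j]; rewrite mem ?permKV ?eqxx // => /eqP <-.
by rewrite permK.
Qed.

(* The last hypothesis only concerns tasks of duration 0: it says that such a
   task starts inside an idle interval, so that its arc in the idle interval
   graph exists.  For tasks of positive duration this is automatic. *)
Theorem theorem4 (R : realType) (T : nat) (I : finType) (a b : I -> R)
    (T_gt0 : (0 < T)%N) (I_gt0 : (0 < #|I|)%N)
    (a_itv : forall i, 0 <= a i < T%:R) (b_itv : forall i, 0 <= b i < T%:R)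
    (arc_defined : forall i, a i = b i -> (load_at T a b (a i) < load T a b)%N) :
  (exists M : {set I * I},
     [/\ periodic_assignment M, fair M & workers T a b M = (load T a b)%:R]) <->
  weakly_connected (idle_interval_graph T a b).
Proof.
have [t0 t0P t0_load] := load_attained a b T_gt0.
split=> [[M [_ /fair_perm[s -> cyc] workersL]]|conn].
  by apply: (@cycle_connected _ _ _ _ _ t0 _ _ _ _ _ _ s) => //; apply/workers_admissible.
have [//|//|//|//|//|//|s sP cyc] := @connected_cycle _ _ _ a b t0 _ _ _ _ _ _ conn.
exists [set (i, s i) | i : I]; split.
- exact: perm_periodic_assignment.
- exact: perm_fair.
- by apply/(@workers_admissible _ _ _ _ _ t0).
Qed.
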